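(* Let $\mathcal{T} \in \mathbb{R}^{d_1\times d_2\times \dots \times d_p}$ be a tensor given as (i.e. represented by) a tensor network with underlying graph $G=(V,E)$, and let $I \subset [p]$. Then, for any cut $\mathcal{C}=(V_1,V_2)$ of the network separating the dangling legs corresponding to the indices in $I$ from those corresponding to the indices in $[p]\setminus I$, $$\operatorname{rank}(\mathcal{T}_{(I)}) \leq \prod_{e \in \mathrm{cutset}(\mathcal{C})} \dim(e),$$ where $\mathrm{cutset}(\mathcal{C})$ is the cut-set of $\mathcal{C}$ and $\dim(e)$ is the dimension of the edge $e$ in the tensor network.
   Context: Notation: $[p]=\{1,\dots,p\}$. Tensor network: a finite set $V$ of vertices, each vertex $v$ carrying a real tensor $\mathcal{G}^{v}$ (a multi-dimensional array) whose modes are called the legs of $v$. Some of the legs (of all vertices taken together) are matched in pairs of equal dimension; each matched pair is an edge $e\in E$ (joining the two vertices owning the legs; parallel edges and loops are allowed), and the common dimension is denoted $\dim(e)$. The unmatched legs are called dangling (free) legs; they are numbered $1,\dots,p$ and leg $n$ has dimension $d_n$. The tensor $\mathcal{T}\in\mathbb{R}^{d_1\times\cdots\times d_p}$ represented by the network is obtained by contraction of all edges: $\mathcal{T}_{i_1,\dots,i_p}$ is the sum, over all assignments of an index $r_e\in[\dim(e)]$ to every edge $e\in E$, of the product over $v\in V$ of the entry of $\mathcal{G}^{v}$ at the indices carried by its legs (index $r_e$ on a leg belonging to edge $e$, index $i_n$ on the $n$-th dangling leg). Matricization: for $I\subset[p]$, $\mathcal{T}_{(I)}$ is the matrix of size $\prod_{i\in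 I}d_i\times\prod_{j\in[p]\setminus I}d_j$ obtained by grouping the modes in $I$ into the row index and the remaining modes into the column index (each grouping ordered lexicographically). Cuts: a cut is a partition $\mathcal{C}=(V_1,V_2)$ of $V$ into two disjoint parts. It separates $I$ from $[p]\setminus I$ if every dangling leg with number in $I$ is attached to a vertex of $V_1$ and every dangling leg with number in $[p]\setminus I$ is attached to a vertex of $V_2$. The cut-set $\mathrm{cutset}(\mathcal{C})$ is the set of edges having one endpoint in $V_1$ and one endpoint in $V_2$ (parallel edges counted separately). An empty product equals $1$. *)

(* Defs.v *)
From HB Require Import structures.
From mathcomp Require Import all_boot all_order all_algebra.
From mathcomp Require Import reals.

Set Implicit Arguments.
Unset Strict Implicit.
Unset Printing Implicit Defensive.

Import Order.TTheory GRing.Theory Num.Theory.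
Local Open Scope ring_scope.

(* Modes and dangling legs are numbered from 0 by 'I_p. *)

Notation multi_index d := {dffun forall l, 'I_(d l)}.

Definition tensor (R : Type) (L : finType) (d : L -> nat) : Type :=
  {ffun multi_index d -> R}.

Section Matricization.

Variables (R : nzRingType) (p : nat) (d : 'I_p -> nat).

(* Component on mode i of the a-th multi-index, in lexicographic order, over
   the modes of J: the smallest mode is the most significant digit. *)
Definition lex_digit (J : {set 'I_p}) (a : nat) (i : 'I_p) : nat :=
  ((a %/ \prod_(j in J | (i < j)%N) d j) %% d i)%N.

Lemma lex_digit_lt (J : {set 'I_p}) (a : 'I_(\prod_(j in J) d j)) (i : 'I_p) :
  i \in J -> (lex_digit J a i < d i)%N.
Proof.
move=> iJ; apply: ltn_pmod; rewrite lt0n; apply/eqP => di0.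
by case: a => a /=; rewrite (bigD1 i) //= di0 mul0n.
Qed.

Lemma merge_digit_lt (I : {set 'I_p}) (a : 'I_(\prod_(j in I) d j))
    (b : 'I_(\prod_(j in ~: I) d j)) (i : 'I_p) :
  ((if i \in I then lex_digit I a i else lex_digit (~: I) b i) < d i)%N.
Proof.
by case: ifPn => iI; apply: lex_digit_lt => //; rewrite inE.
Qed.

Definition merge_index (I : {set 'I_p}) (a : 'I_(\prod_(j in I) d j))
    (b : 'I_(\prod_(j in ~: I) d j)) : multi_index d :=
  finfun (fun i => Ordinal (merge_digit_lt a b i)).

Definition matricization (I : {set 'I_p}) (T : tensor R d) :
    'M[R]_(\prod_(j in I) d j, \prod_(j in ~: I) d j) :=
  \matrix_(a, b) T (merge_index a b).

End Matricization.

(* The two matched legs of an edge e are (e, false) and (e, true); which one is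
   which carries no meaning. Parallel edges and loops are allowed. *)
Record network_graph (p : nat) := NetworkGraph {
  vertex : finType;
  edge : finType;
  edge_end : edge -> bool -> vertex;
  edge_dim : edge -> nat;
  dangling_end : 'I_p -> vertex
}.

Section Legs.

Variables (p : nat) (d : 'I_p -> nat) (G : network_graph p).

Definition leg : finType := (edge G * bool + 'I_p)%type.

Definition leg_owner (l : leg) : vertex G :=
  match l with
  | inl h => edge_end h.1 h.2
  | inr n => dangling_end G n
  end.

Definition leg_dim (l : leg) : nat :=
  match l with
  | inl h => edge_dim h.1
  | inr n => d n
  end.

Definition leg_index (r : multi_index (@edge_dim p G)) (i : multi_index d)
    (l : leg) : 'I_(leg_dim l) :=
  match l with
  | inl h => r h.1
  | inr n => i n
  end.

Definition legs_at (v : vertex G) : finType := {l : leg | leg_owner l == v}.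

Definition leg_dim_at (v : vertex G) (l : legs_at v) : nat := leg_dim (val l).

Definition leg_index_at (r : multi_index (@edge_dim p G)) (i : multi_index d)
    (v : vertex G) : multi_index (@leg_dim_at v) :=
  finfun (fun l : legs_at v => leg_index r i (val l)).

End Legs.

Record tensor_network (R : nzRingType) (p : nat) (d : 'I_p -> nat) :=
  TensorNetwork {
    graph :> network_graph p;
    vertex_tensor : forall v : vertex graph, tensor R (@leg_dim_at p d graph v)
  }.

Definition contraction (R : comNzRingType) (p : nat) (d : 'I_p -> nat)
    (N : tensor_network R d) : tensor R d :=
  [ffun i : multi_index d =>
    \sum_(r : multi_index (@edge_dim p N))
      \prod_(v : vertex N) vertex_tensor v (leg_index_at r i v)].

Definition represents (R : comNzRingType) (p : nat) (d : 'I_p -> nat)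
    (N : tensor_network R d) (T : tensor R d) : Prop :=
  T = contraction N.

Section Cuts.

Variables (p : nat) (G : network_graph p).

(* Either part may be empty. *)
Record cut := Cut {
  cut_left : {set vertex G};
  cut_right : {set vertex G};
  cut_cover : cut_left :|: cut_right = [set: vertex G];
  cut_disjoint : [disjoint cut_left & cut_right]
}.

Definition separates (C : cut) (I : {set 'I_p}) : Prop :=
  forall n : 'I_p,
    (n \in I -> dangling_end G n \in cut_left C) /\
    (n \notin I -> dangling_end G n \in cut_right C).

Definition cutset (C : cut) : {set edge G} :=
  [set e | [exists s : bool, (edge_end e s \in cut_left C) &&
                             (edge_end e (~~ s) \in cut_right C)]].

End Cuts.

(* Main.v *)
Require Import Defs.
From HB Require Import structures.
From mathcomp Require Import all_boot all_order all_algebra.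
From mathcomp Require Import reals.

Set Implicit Arguments.
Unset Strict Implicit.
Unset Printing Implicit Defensive.

Import Order.TTheory GRing.Theory Num.Theory.
Local Open Scope ring_scope.

(** Once the indices of the cut edges are fixed, the part of the contraction on
    the left of the cut and the part on its right share no summation index, so
    the matricization is a sum of one rank-one matrix per assignment of indices
    to the cut edges. The factorization of the inner sum is obtained without
    splitting the index type: if [f] only reads the left coordinates and [g]
    only the right ones, exchanging the right coordinates of [r] and [r'] is an
    involution on pairs of assignments with the same cut indices, which turns
    [f r * g r'] into [f s * g s]. Hence
    [(\sum_r f r) * (\sum_r g r) = k * \sum_r f r * g r] where [k] is the number
    of such assignments, and one divides by [k]. *)

Lemma card_multi_index (L : finType) (d : L -> nat) :
  #|multi_index d| = (\prod_l d l)%N.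
Proof.
rewrite card_dep_ffun foldrE big_map big_enum /=.
by apply: eq_bigr => l _; rewrite card_ord.
Qed.

Section MixedSums.

Variables (R : numFieldType) (K : finType) (mix : K -> K -> K).

Lemma sum_mul_mix (P : pred K) (f g : K -> R) :
    (forall r r', P r -> P r' -> P (mix r r')) ->
    (forall r r', mix (mix r r') (mix r' r) = r) ->
    (forall r r', P r -> P r' -> f (mix r r') = f r) ->
    (forall r r', P r -> P r' -> g (mix r r') = g r') ->
  \sum_(r | P r) f r * g r =
    (#|P|%:R^-1 * \sum_(r | P r) f r) * \sum_(r | P r) g r.
Proof.
(* An empty [P], which occurs when an uncut edge has dimension 0, is set apart so that [#|P|] can be
   inverted. *)
move=> Pmix mixK fmix gmix; have [P0|Pn0] := posnP #|P|.
  by rewrite !big_pred0 ?mulr0 // => r; have := card0_eq P0 r.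
suff E : #|P|%:R * (\sum_(r | P r) f r * g r) =
         (\sum_(r | P r) f r) * (\sum_(r | P r) g r).
  by rewrite -mulrA -E mulKf // pnatr_eq0 -lt0n.
rewrite big_distrlr /= pair_big /=.
pose swap (q : K * K) := (mix q.1 q.2, mix q.2 q.1).
have swapK : involutive swap by case=> r r'; rewrite /swap /= !mixK.
have swapP q : P (swap q).1 && P (swap q).2 = P q.1 && P q.2.
  (* One implication suffices: applied to [swap q] it gives the converse. *)
  have half q' : P q'.1 && P q'.2 -> P (swap q').1 && P (swap q').2.
    by case/andP=> P1 P2; rewrite /= !Pmix.
  by apply/idP/idP => [/half|/half//]; rewrite swapK.
rewrite [RHS](reindex_inj (inv_inj swapK)) (eq_bigl _ _ swapP).
rewrite (eq_bigr (fun q => f q.1 * g q.1)); last first.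
  by move=> [r r'] /andP[/= Pr Pr']; rewrite fmix ?gmix.
rewrite -(pair_big P P (fun r _ => f r * g r)) /= mulr_sumr.
by apply: eq_bigr => r _; rewrite sumr_const mulr_natl.
Qed.

(** Group the sum by the value of [key]. On each fibre [sum_mul_mix] separates [a] from [b], so the
    matrix factors through dimension [#|J|]; the left factor absorbs the division by the size of the
    fibre. *)
Lemma rank_sum_mul_mix (J : finType) (key : K -> J) (m n : nat)
    (f : K -> 'I_m -> R) (g : K -> 'I_n -> R) :
    (forall r r', key r = key r' -> key (mix r r') = key r) ->
    (forall r r', mix (mix r r') (mix r' r) = r) ->
    (forall r r', key r = key r' -> f (mix r r') =1 f r) ->
    (forall r r', key r = key r' -> g (mix r r') =1 g r') ->
  (\rank (\matrix_(a, b) \sum_r f r a * g r b)%R <= #|J|)%N.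
Proof.
move=> keymix mixK fmix gmix.
pose P j := [pred r | key r == j].
pose A : 'M[R]_(m, #|J|) := \matrix_(a, j)
  (#|P (enum_val j)|%:R^-1 * \sum_(r | P (enum_val j) r) f r a).
pose B : 'M[R]_(#|J|, n) := \matrix_(j, b) \sum_(r | P (enum_val j) r) g r b.
suff -> : \matrix_(a, b) (\sum_r f r a * g r b) = A *m B.
  exact: mulmx_max_rank.
apply/matrixP => a b; rewrite !mxE (partition_big key predT) //=.
rewrite (reindex _ (onW_bij _ (enum_val_bij J))) /=; apply: eq_bigr => j _.
rewrite !mxE; apply: sum_mul_mix => // r r' /eqP kr /eqP kr' /=.
- by rewrite keymix kr ?kr'.
- by apply: fmix; rewrite kr kr'.
- by apply: gmix; rewrite kr kr'.
Qed.

End MixedSums.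

Section NetworkIndices.

Variables (p : nat) (d : 'I_p -> nat) (G : network_graph p).

Implicit Types (r : multi_index (@edge_dim p G)) (v : vertex G).

Lemma eq_leg_index_at r r' (i i' : multi_index d) v :
    (forall e s, edge_end e s = v -> r e = r' e) ->
    (forall n, dangling_end G n = v -> i n = i' n) ->
  leg_index_at r i v = leg_index_at r' i' v.
Proof.
move=> eqr eqi; apply/ffunP => -[l lv]; rewrite !ffunE /=.
by case: l lv => [[e s]|n] /= lv; [apply: (eqr e s)|apply: eqi]; apply/eqP.
Qed.

Lemma merge_index_left (I : {set 'I_p}) (a : 'I_(\prod_(j in I) d j))
    (b b' : 'I_(\prod_(j in ~: I) d j)) i :
  i \in I -> merge_index a b i = merge_index a b' i.
Proof. by move=> iI; apply: val_inj; rewrite !ffunE /= iI. Qed.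

Lemma merge_index_right (I : {set 'I_p}) (a a' : 'I_(\prod_(j in I) d j))
    (b : 'I_(\prod_(j in ~: I) d j)) i :
  i \notin I -> merge_index a b i = merge_index a' b i.
Proof. by move=> /negbTE iI; apply: val_inj; rewrite !ffunE /= iI. Qed.

Variable C : cut G.

Lemma in_cut_right v : (v \in cut_right C) = (v \notin cut_left C).
Proof.
have /setP/(_ v) := cut_cover C; rewrite !inE.
have [vl _|//] := boolP (v \in cut_left C).
by rewrite (disjointFr (cut_disjoint C) vl).
Qed.

Definition meets_left (e : edge G) : bool :=
  [exists s, edge_end e s \in cut_left C].

(** Cut edges take their index from [r]; when [r] and [r'] agree on the cut, this choice is
    immaterial. *)
Definition mix_index r r' : multi_index (@edge_dim p G) :=
  finfun (fun e => if meets_left e then r e else r' e).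

Definition cut_index r :
    multi_index (fun e : {e | e \in cutset C} => edge_dim (val e)) :=
  finfun (fun e => r (val e)).

Lemma cut_index_eq r r' e :
  cut_index r = cut_index r' -> e \in cutset C -> r e = r' e.
Proof. by move=> /ffunP E eC; have := E (Sub e eC); rewrite !ffunE. Qed.

Lemma mix_indexK r r' : mix_index (mix_index r r') (mix_index r' r) = r.
Proof. by apply/ffunP => e; rewrite !ffunE; case: meets_left. Qed.

Lemma cut_index_mix r r' :
  cut_index r = cut_index r' -> cut_index (mix_index r r') = cut_index r.
Proof.
move=> E; apply/ffunP => e; rewrite !ffunE.
by case: ifP => // _; rewrite (cut_index_eq E (valP e)).
Qed.

Lemma mix_index_left r r' e s :
  edge_end e s \in cut_left C -> mix_index r r' e = r e.
Proof. by move=> es; rewrite ffunE ifT //; apply/existsP; exists s. Qed.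

(** An edge with a right end either has no left end, hence is read from [r'], or is cut, and there
    [r] and [r'] agree. *)
Lemma mix_index_right r r' e s :
    cut_index r = cut_index r' -> edge_end e s \in cut_right C ->
  mix_index r r' e = r' e.
Proof.
move=> E es; rewrite ffunE; case: ifP => // /existsP[t et].
apply: cut_index_eq E _; rewrite inE; apply/existsP; exists t; rewrite et.
(* End [t] is on the left and end [s] on the right, so they are the two distinct ends of [e]. *)
suff -> : ~~ t = s by [].
by case: t s et es => [] [] et; rewrite in_cut_right ?et.
Qed.

End NetworkIndices.

Theorem theorem9 (R : realType) (p : nat) (d : 'I_p -> nat) (T : tensor R d)
    (N : tensor_network R d) (hT : represents N T)
    (I : {set 'I_p}) (C : cut N) (hC : separates C I) :
  (\rank (matricization I T) <= \prod_(e in cutset C) edge_dim e)%N.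
Proof.
(* A matrix without rows or columns has rank 0. Otherwise some [a0] and [b0] exist, to serve as
   fillers below. *)
have [a0 _|noa] := pickP (@predT 'I_(\prod_(j in I) d j)); last first.
  apply: leq_trans (rank_leq_row _) _.
  by rewrite -[X in (X <= _)%N]card_ord eq_card0.
have [b0 _|nob] := pickP (@predT 'I_(\prod_(j in ~: I) d j)); last first.
  apply: leq_trans (rank_leq_col _) _.
  by rewrite -[X in (X <= _)%N]card_ord eq_card0.
(* Left vertices carry only dangling legs in [I], so the filler [b0] is never read; likewise [a0] in
   [g]. *)
pose f r a := \prod_(v in cut_left C)
  vertex_tensor v (leg_index_at r (merge_index a b0) v).
pose g r b := \prod_(v | v \notin cut_left C)
  vertex_tensor v (leg_index_at r (merge_index a0 b) v).
have danglingI n v : dangling_end N n = v -> (n \in I) = (v \in cut_left C).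
  move=> <-; have [hl hr] := hC n.
  have [/hl-> //|/hr] := boolP (n \in I).
  by rewrite in_cut_right => /negbTE.
have -> : matricization I T = \matrix_(a, b) \sum_r f r a * g r b.
  apply/matrixP => a b; rewrite !mxE hT ffunE; apply: eq_bigr => r _.
  rewrite (bigID (mem (cut_left C))) /=.
  congr (_ * _); apply: eq_bigr => v vC; congr (vertex_tensor v _);
    apply: eq_leg_index_at => // n nv.
    by apply: merge_index_left; rewrite (danglingI n v).
  by apply: merge_index_right; rewrite (danglingI n v).
(* The bound becomes the number of index assignments to the cut edges, the values of the key
   [cut_index]. *)
rewrite [X in (_ <= X)%N]big_sub -[X in (_ <= X)%N]card_multi_index.
apply: (@rank_sum_mul_mix _ _ (@mix_index _ _ C) _ (@cut_index _ _ C)).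
- exact: cut_index_mix.
- exact: mix_indexK.
- move=> r r' _ a; apply: eq_bigr => v vC; congr (vertex_tensor v _).
  apply: eq_leg_index_at => // e s es.
  by apply: (@mix_index_left _ _ _ _ _ _ s); rewrite es.
- move=> r r' E b; apply: eq_bigr => v vC; congr (vertex_tensor v _).
  apply: eq_leg_index_at => // e s es.
  by apply: (@mix_index_right _ _ _ _ _ _ s); rewrite // es in_cut_right.
Qed.
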